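(* Let $X$ be a Banach space, let $(A_m)_{m\ge 0}$ be a sequence of bounded linear operators on $X$ that admits an exponential dichotomy on $\mathbb Z_0^+=\{0,1,2,\dots\}$, and let $B$ be an admissible Banach sequence space over $\mathbb Z$. Then for all sufficiently small $c>0$ the following holds (i.e. there is $c_0>0$, depending only on $(A_m)_{m\ge 0}$ and $B$, such that it holds for every $0<c<c_0$): for every sequence of maps $f_n\colon X\to X$, $n\ge 0$, satisfying $\|f_n(x)-f_n(y)\|\le c\|x-y\|$ for all $n\ge 0$ and $x,y\in X$, the system $x_{n+1}=F_n(x_n)$, $n\ge 0$, where $F_n:=A_n+f_n$, has the $B$-shadowing property.
   Context: **Admissible Banach sequence spaces.** Let $\mathcal S(\mathbb Z)$ be the set of all real sequences $\mathbf s=(s_n)_{n\in\mathbb Z}$. A linear subspace $B\subset\mathcal S(\mathbb Z)$ with a norm $\|\cdot\|_B$ is a normed sequence space if whenever $\mathbf s'\in B$ and $|s_n|\le|s_n'|$ for all $n\in\mathbb Z$, then $\mathbf s\in B$ and $\|\mathbf s\|_B\le\|\mathbf s'\|_B$. If it is complete, it is a Banach sequence space. A Banach sequence space $B$ is admissible if (1) $\chi_{\{n\}}\in B$ and $\|\chi_{\{n\}}\|_B>0$ for all $n\in\mathbb Z$ ($\chi$ denotes the characteristic function); (2) for each $\mathbf s\in B$ and $m\in\mathbb Z$ the shifted sequence $(s_{n+m})_{n\in\mathbb Z}$ belongs to $B$ and has the same norm as $\mathbf s$. It is assumed throughout that $\|\chi_{\{0\}}\|_B=1$. For a Banach space $X$,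 $X_B$ is the Banach space of sequences $\mathbf x=(x_n)_{n\in\mathbb Z}\subset X$ with $(\|x_n\|)_{n\in\mathbb Z}\in B$, with norm $\|\mathbf x\|_B:=\|(\|x_n\|)_{n\in\mathbb Z}\|_B$. For a one-sided sequence $\mathbf x=(x_n)_{n\ge 0}\subset X$ let $\bar{\mathbf x}=(\bar x_n)_{n\in\mathbb Z}$ with $\bar x_n=x_n$ for $n\ge 0$ and $\bar x_n=0$ for $n<0$. Then $X_B^+:=\{\mathbf x=(x_n)_{n\ge 0}\subset X:\bar{\mathbf x}\in X_B\}$ is a Banach space with norm $\|\mathbf x\|_B^+:=\|\bar{\mathbf x}\|_B$. **Exponential dichotomy on $\mathbb Z_0^+$.** For $m\ge n\ge 0$ set $\mathcal A(m,n)=A_{m-1}\cdots A_n$ if $m>n$ and $\mathcal A(m,m)=\mathrm{Id}$. The sequence $(A_m)_{m\ge 0}$ admits an exponential dichotomy if: (1) there are projections $P_m$, $m\ge 0$, on $X$ with $P_{m+1}A_m=A_mP_m$ for all $m\ge 0$; (2) $A_m|_{\ker P_m}\colon\ker P_m\to\ker P_{m+1}$ is invertible for all $m\ge 0$; (3) there exist $C,\lambda>0$ such that for $m,n\ge 0$, $\|\mathcal A(m,n)P_n\|\le Ce^{-\lambda(m-n)}$ if $m\ge n$ and $\|\mathcal A(m,n)(\mathrm{Id}-P_n)\|\le Ce^{-\lambda(n-m)}$ if $m\le n$, where for $m\le n$, $\mathcal A(m,n):=(\mathcal A(n,m)|_{\ker P_m})^{-1}\colon\ker P_n\to\ker P_m$.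 **Shadowing.** For $\delta>0$, a sequence $(y_n)_{n\ge 0}\subset X$ is a $(\delta,B)$-pseudotrajectory for $x_{n+1}=F_n(x_n)$, $n\ge 0$, if $(y_{n+1}-F_n(y_n))_{n\ge 0}\in X_B^+$ and $\|(y_{n+1}-F_n(y_n))_{n\ge 0}\|_B^+\le\delta$. The system has the $B$-shadowing property if for every $\varepsilon>0$ there is $\delta>0$ such that for every $(\delta,B)$-pseudotrajectory $(y_n)_{n\ge 0}$ there is a sequence $(x_n)_{n\ge 0}$ with $x_{n+1}=F_n(x_n)$ for all $n\ge 0$, $(x_n-y_n)_{n\ge 0}\in X_B^+$ and $\|(x_n-y_n)_{n\ge 0}\|_B^+\le\varepsilon$. *)

(* Defs.v *)
From HB Require Import structures.
From mathcomp Require Import all_boot all_order all_algebra.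
From mathcomp Require Import all_classical all_reals all_analysis.

Set Implicit Arguments.
Unset Strict Implicit.
Unset Printing Implicit Defensive.

Import Order.TTheory GRing.Theory Num.Theory.
Import numFieldNormedType.Exports.

Local Open Scope classical_set_scope.
Local Open Scope ring_scope.

(* The subspace is the carrier [seq_in]; the values of [seq_norm] outside
   [seq_in] are unconstrained. *)
Record normedSeqSpace (R : realType) := NormedSeqSpace {
  seq_in : set (int -> R);
  seq_norm : (int -> R) -> R;
  seq_in0 : seq_in (fun=> 0);
  seq_inD : forall s t, seq_in s -> seq_in t -> seq_in (fun n => s n + t n);
  seq_inZ : forall a s, seq_in s -> seq_in (fun n => a * s n);
  seq_norm_ge0 : forall s, seq_in s -> 0 <= seq_norm s;
  seq_norm_eq0 : forall s, seq_in s -> seq_norm s = 0 -> s = (fun=> 0);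
  seq_normD : forall s t, seq_in s -> seq_in t ->
    seq_norm (fun n => s n + t n) <= seq_norm s + seq_norm t;
  seq_normZ : forall a s, seq_in s ->
    seq_norm (fun n => a * s n) = `|a| * seq_norm s;
  seq_solid : forall s s', seq_in s' -> (forall n, `|s n| <= `|s' n|) ->
    seq_in s /\ seq_norm s <= seq_norm s'
}.

Definition banach_seq_space (R : realType) (B : normedSeqSpace R) : Prop :=
  forall u : nat -> int -> R,
    (forall k, seq_in B (u k)) ->
    (forall e : R, 0 < e -> exists N : nat, forall i j : nat,
      (N <= i)%N -> (N <= j)%N -> seq_norm B (fun n => u i n - u j n) < e) ->
    exists2 s, seq_in B s &
      forall e : R, 0 < e -> exists N : nat, forall k : nat,
        (N <= k)%N -> seq_norm B (fun n => u k n - s n) < e.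

(* The last clause is a normalization. *)
Definition admissible (R : realType) (B : normedSeqSpace R) : Prop :=
  [/\ banach_seq_space B,
      forall n : int, seq_in B \1_[set n] /\ 0 < seq_norm B \1_[set n],
      forall (s : int -> R) (m : int), seq_in B s ->
        seq_in B (fun n => s (n + m)) /\
        seq_norm B (fun n => s (n + m)) = seq_norm B s &
      seq_norm B \1_[set (0 : int)] = 1].

Section SequencesInX.
Context {R : realType} {X : completeNormedModType R} (B : normedSeqSpace R).

Definition XB : set (int -> X) := [set x | seq_in B (fun n => `|x n|)].

Definition normXB (x : int -> X) : R := seq_norm B (fun n => `|x n|).

(* [Posz n] is the integer [n] and [Negz n] is [- n.+1]. *)
Definition extend0 (x : nat -> X) : int -> X :=
  fun n => match n with Posz k => x k | Negz _ => 0 end.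

Definition XBplus : set (nat -> X) := [set x | XB (extend0 x)].

Definition normXBplus (x : nat -> X) : R := normXB (extend0 x).

End SequencesInX.

Section Dichotomy.
Context {R : realType} {X : completeNormedModType R}.

(* The operator norm of [T] is at most [K]. *)
Definition opnorm_le (T : X -> X) (K : R) : Prop :=
  forall x, `|T x| <= K * `|x|.

Definition bounded_op (T : X -> X) : Prop := exists K : R, opnorm_le T K.

Definition null_space (T : X -> X) : set X := [set x | T x = 0].

(* [compose_from A n k] is [A (n + k - 1) \o ... \o A n]. *)
Fixpoint compose_from (A : nat -> X -> X) (n k : nat) : X -> X :=
  if k is k'.+1 then A (n + k')%N \o compose_from A n k' else id.

(* For [m < n] this is the inverse of the restriction of [evolution A P n m]
   to [null_space (P m)], extended by 0 outside the image of that subspace. *)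
Definition evolution (A P : nat -> X -> X) (m n : nat) : X -> X :=
  if (n <= m)%N then compose_from A n (m - n)%N
  else 'pinv_(fun=> 0) (null_space (P m)) (compose_from A m (n - m)%N).

(* Boundedness of the [P m] is the case [m = n] of the first estimate. *)
Definition exponential_dichotomy (A : nat -> {linear X -> X}) : Prop :=
  exists P : nat -> {linear X -> X},
  [/\ forall m x, P m (P m x) = P m x,
      forall m x, P m.+1 (A m x) = A m (P m x),
      forall m, set_bij (null_space (P m)) (null_space (P m.+1)) (A m) &
      exists C lambda : R,
      [/\ 0 < C, 0 < lambda,
          forall m n : nat, (n <= m)%N ->
            opnorm_le (evolution A P m n \o P n)
              (C * expR (- lambda * (m - n)%N%:R)) &
          forall m n : nat, (m <= n)%N ->
            opnorm_le (evolution A P m n \o (fun x => x - P n x))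
              (C * expR (- lambda * (n - m)%N%:R))]].

End Dichotomy.

Section Shadowing.
Context {R : realType} {X : completeNormedModType R}.
Variables (B : normedSeqSpace R) (F : nat -> X -> X).

Definition pseudotrajectory (delta : R) (y : nat -> X) : Prop :=
  XBplus B (fun n => y n.+1 - F n (y n)) /\
  normXBplus B (fun n => y n.+1 - F n (y n)) <= delta.

Definition shadowing_property : Prop :=
  forall eps : R, 0 < eps ->
  exists2 delta : R, 0 < delta &
  forall y : nat -> X, pseudotrajectory delta y ->
  exists x : nat -> X,
  [/\ forall n, x n.+1 = F n (x n),
      XBplus B (fun n => x n - y n) &
      normXBplus B (fun n => x n - y n) <= eps].

End Shadowing.

(* Main.v *)
Require Import Defs.
From mathcomp Require Import all_boot all_order all_algebra.
From mathcomp Require Import all_classical all_reals all_analysis.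
From mathcomp Require Import zify ring lra.
Import Order.TTheory GRing.Theory Num.Theory.
Import numFieldNormedType.Exports.
Local Open Scope classical_set_scope.
Local Open Scope ring_scope.

Set Implicit Arguments.
Unset Strict Implicit.
Unset Printing Implicit Defensive.

(** Write [w] for the error of a pseudotrajectory [y] and look for the true
    trajectory as [y + v].  The correction [v] has to solve
    [v_{n+1} = A_n v_n + g_n(v_n) - w_n], where
    [g_n(v) = f_n(y_n + v) - f_n(y_n)] is [c]-Lipschitz.

    The linear input is that, thanks to the dichotomy, the affine equation
    [d_{n+1} = A_n d_n + h_n] has for every [h] in [X_B^+] a solution [d] in
    [X_B^+] with [|d| <= K |h|] ([dichotomy_affine_solvable]).  It is given by
    the Green function: the stable parts of the past values of [h] are
    transported forwards, the unstable parts of its future values backwards.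
    Indexing both sums by the distance [j] to the current time, the [j]-th
    term is bounded by [C q^j] times a shift of [|h|], with
    [q = exp(-lambda)], and shifts are isometries of [B]; so each sum is
    dominated by a geometric series in [B].

    The nonlinear equation is then solved by repeated correction
    ([affine_solvable_shadowing]): solve it with [g] dropped, then solve the
    affine equation whose forcing term is the change of [g] caused by the last
    correction, and so on.  Each correction is [K c] times smaller than the
    preceding one, so for [c < K^-1] the corrections again form a geometric
    series in [X_B^+].  Its sum is a solution because the equation at each time
    involves only finitely many entries, on which all maps are continuous.

    Both limits rest on [XBplus_geometric_series]: a series in [X_B^+] whose
    norms decay geometrically converges entrywise to an element of [X_B^+],
    with the expected bound.  It follows from the completeness of [B] and from
    the fact that evaluation at an index is bounded on [B]. *)

(** * Admissible sequence spaces *)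

Section SequenceSpace.
Context {R : realType} (B : normedSeqSpace R).

Lemma seq_inB s t : seq_in B s -> seq_in B t -> seq_in B (fun n => s n - t n).
Proof.
move=> Bs Bt; have := seq_inD Bs (seq_inZ (-1) Bt).
by congr (seq_in B _); apply/funext => n; rewrite mulN1r.
Qed.

Lemma seq_norm_distC s t : seq_in B s -> seq_in B t ->
  seq_norm B (fun n => s n - t n) = seq_norm B (fun n => t n - s n).
Proof.
move=> Bs Bt; rewrite -[RHS]mul1r -(normrN1 R) -seq_normZ; last exact: seq_inB.
by congr (seq_norm B _); apply/funext => n; rewrite mulN1r opprB.
Qed.

(** Solidity bounds [`|s n|] times the norm of the indicator of [n], and that
    norm is 1 by shift invariance.  Hence convergence in [B] implies
    entrywise convergence. *)
Lemma normr_le_seq_norm s (n : int) : admissible B -> seq_in B s ->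
  `|s n| <= seq_norm B s.
Proof.
move=> [_ B1 Bshift B1E] Bs.
have norm1 : seq_norm B \1_[set n] = 1.
  rewrite -B1E -(Bshift \1_[set 0] (- n) (B1 0).1).2.
  congr (seq_norm B _); apply/funext => k; rewrite !indicE !in_set1.
  by rewrite subr_eq0.
rewrite -[leLHS]mulr1 -norm1 -seq_normZ; last exact: (B1 n).1.
apply: (seq_solid Bs _).2 => k.
rewrite indicE in_set1; case: eqP => [->|_]; first by rewrite mulr1.
by rewrite mulr0 normr0.
Qed.

End SequenceSpace.

Lemma geometric_eventually_lt {R : realType} (K q e : R) :
  0 <= q < 1 -> 0 < e -> exists N, forall k, (N <= k)%N -> K * q ^+ k < e.
Proof.
move=> /andP[q0 q1] e0.
have /(cvgr_lt _)/(_ _ e0)[N _ HN] : geometric K q @ \oo --> 0.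
  by apply: cvg_geometric; rewrite ger0_norm.
by exists N => k Nk; exact: HN.
Qed.

(** The partial sums are Cauchy, so they have a limit in [B]; entries being
    controlled by the norm, this limit is the entrywise sum. *)
Lemma seq_geometric_series {R : realType} (B : normedSeqSpace R)
    (u : nat -> int -> R) (M q : R) :
  admissible B -> 0 <= q < 1 ->
  (forall j, seq_in B (u j)) -> (forall j, seq_norm B (u j) <= M * q ^+ j) ->
  exists s, [/\ seq_in B s, seq_norm B s <= M / (1 - q) &
    forall n, series (u^~ n) @ \oo --> s n].
Proof.
move=> Badm q01 uB uM; have /andP[q0 q1] := q01.
set K := M / (1 - q).
have M0 : 0 <= M.
  by apply: le_trans (seq_norm_ge0 (uB 0%N)) _; rewrite (le_trans (uM 0%N))// mulr1.
have K0 : 0 <= K by rewrite divr_ge0// subr_ge0 ltW.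
pose U N (n : int) := series (u^~ n) N.
have UB N : seq_in B (U N).
  elim: N => [|N IH].
    rewrite (_ : U 0%N = fun=> 0); first exact: seq_in0.
    by apply/funext => n; rewrite /U /series /= big_geq.
  have := seq_inD IH (uB N); congr (seq_in B _); apply/funext => n.
  by rewrite /U seriesSr.
(* The difference of powers on the right telescopes with [M * q ^+ j], which
   makes the induction on [p] close. *)
have tail i p : seq_norm B (fun n => U (i + p)%N n - U i n) <=
    K * (q ^+ i - q ^+ (i + p)).
  elim: p => [|p IH].
    rewrite addn0 subrr mulr0; have := seq_normZ 0 (uB 0%N).
    rewrite normr0 mul0r => <-; rewrite le_eqVlt; apply/orP; left; apply/eqP.
    by congr (seq_norm B _); apply/funext => n; rewrite subrr mul0r.
  have -> : (fun n => U (i + p.+1)%N n - U i n) =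
            (fun n => (U (i + p)%N n - U i n) + u (i + p)%N n).
    by apply/funext => n; rewrite addnS /U seriesSr; ring.
  apply: le_trans (seq_normD (seq_inB (UB _) (UB _)) (uB _)) _.
  apply: le_trans (lerD IH (uM _)) _.
  rewrite le_eqVlt; apply/orP; left; apply/eqP.
  rewrite addnS exprS /K; field; rewrite subr_eq0; lra.
have tail' i j : (i <= j)%N ->
    seq_norm B (fun n => U j n - U i n) <= K * q ^+ i.
  move=> ij; have := tail i (j - i)%N; rewrite subnKC// => /le_trans; apply.
  by rewrite ler_wpM2l// lerBlDr lerDl exprn_ge0.
have [Bcomplete _ _ _] := Badm.
have [|s Bs Us] := Bcomplete U UB.
  move=> e e0; have [N HN] := geometric_eventually_lt K q01 e0.
  exists N => i j Ni Nj; case: (leqP i j) => [ij|/ltnW ji].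
    by rewrite seq_norm_distC//; apply: le_lt_trans (tail' _ _ ij) (HN _ Ni).
  by apply: le_lt_trans (tail' _ _ ji) (HN _ Nj).
exists s; split => //.
- apply/ler_addgt0Pr => e e0; have [N HN] := Us e e0.
  have -> : s = fun n => U N n + (s n - U N n) by apply/funext => n; rewrite addrC subrK.
  apply: le_trans (seq_normD (UB _) (seq_inB Bs (UB _))) _.
  rewrite lerD//; last by rewrite seq_norm_distC// ltW// HN.
  have := tail' 0%N N (leq0n _); rewrite mulr1; congr (_ <= _).
  by congr (seq_norm B _); apply/funext => n; rewrite /U {2}/series /= big_geq// subr0.
- move=> n; apply/cvgrPdist_lt => e e0; have [N HN] := Us e e0.
  exists N => // k Nk /=; rewrite distrC.
  apply: le_lt_trans (normr_le_seq_norm n Badm (seq_inB (UB k) Bs)) _; exact: HN.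
Qed.

(** * Sequences with values in a Banach space *)

Section SequencesInX.
Context {R : realType} {X : completeNormedModType R} (B : normedSeqSpace R).

Lemma XBplus_dominated (x : nat -> X) s : seq_in B s ->
  (forall n, `|extend0 x n| <= s n) ->
  XBplus B x /\ normXBplus B x <= seq_norm B s.
Proof.
by move=> Bs xs; apply: seq_solid Bs _ => n; rewrite normr_id (le_trans (xs n))// ler_norm.
Qed.

Lemma XBplusB (x y : nat -> X) : XBplus B x -> XBplus B y ->
  XBplus B (fun n => x n - y n) /\
  normXBplus B (fun n => x n - y n) <= normXBplus B x + normXBplus B y.
Proof.
move=> Bx By.
have [|? le_xy] := @XBplus_dominated (fun n => x n - y n) _ (seq_inD Bx By).
  by case=> n /=; [exact: ler_normB|rewrite normr0 addr0].
by split=> //; apply: le_trans le_xy _; exact: seq_normD.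
Qed.

Lemma XBplus_lipschitz (x y : nat -> X) c : XBplus B x -> 0 <= c ->
  (forall n, `|y n| <= c * `|x n|) ->
  XBplus B y /\ normXBplus B y <= c * normXBplus B x.
Proof.
move=> Bx c0 yx; rewrite -[X in X * _](ger0_norm c0) -seq_normZ//.
apply: XBplus_dominated; first exact: seq_inZ.
by case=> n //=; rewrite normr0 mulr0.
Qed.

(** The norms [`|d j m|] sum, in [B], to a sequence [s]; in particular they are
    summable for each [m], so [X] being complete the vector series converge,
    and [s] dominates their sums. *)
Lemma XBplus_geometric_series (d : nat -> nat -> X) (M q : R) :
  admissible B -> 0 <= q < 1 -> (forall j, XBplus B (d j)) ->
  (forall j, normXBplus B (d j) <= M * q ^+ j) ->
  exists z, [/\ XBplus B z, normXBplus B z <= M / (1 - q) &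
    forall m, series (d^~ m) @ \oo --> z m].
Proof.
move=> Badm q01 dB dM.
have [s [Bs sM sE]] := seq_geometric_series Badm q01 dB dM.
have cvgd m : cvgn (series (d^~ m)).
  by apply: normed_cvg; apply/cvg_ex; exists (s (Posz m)); exact: (sE (Posz m)).
exists (fun m => limn (series (d^~ m))).
have [|zB zs] := @XBplus_dominated (fun m => limn (series (d^~ m))) s Bs.
  case=> m.
    rewrite -(cvg_lim _ (sE (Posz m)))//; apply: lim_series_norm.
    by apply/cvg_ex; exists (s (Posz m)); exact: (sE (Posz m)).
  rewrite /= normr0 -(cvg_lim _ (sE (Negz m)))//.
  apply: limr_ge; first by apply/cvg_ex; exists (s (Negz m)); exact: sE.
  by apply: nearW => N; apply: sumr_ge0.
by split=> //; apply: le_trans zs sM.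
Qed.

(** The form in which convolution with a geometrically decaying kernel acts
    boundedly on [X_B^+]: [sigma j] is the displacement between the time at which
    the [j]-th term is evaluated and the time at which it reads [h]. *)
Lemma XBplus_shifted_series (h : nat -> X) (e : nat -> nat -> X)
    (sigma : nat -> int) (C q : R) :
  admissible B -> 0 <= C -> 0 <= q < 1 -> XBplus B h ->
  (forall j m : nat, `|e j m| <= C * q ^+ j * `|extend0 h (m%:Z + sigma j)|) ->
  exists z, [/\ XBplus B z, normXBplus B z <= C / (1 - q) * normXBplus B h &
    forall m, series (e^~ m) @ \oo --> z m].
Proof.
move=> Badm C0 q01 Bh eh; have [_ _ Bshift _] := Badm.
have /andP[q0 _] := q01.
have shiftB j := Bshift _ (sigma j) Bh.
have eB j : XBplus B (e j) /\
    normXBplus B (e j) <= C * normXBplus B h * q ^+ j.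
  rewrite mulrAC -(ger0_norm (mulr_ge0 C0 (exprn_ge0 j q0))).
  rewrite /normXBplus /normXB -(shiftB j).2 -seq_normZ; last exact: (shiftB j).1.
  apply: XBplus_dominated; first by apply: seq_inZ; exact: (shiftB j).1.
  by case=> n /=; rewrite ?normr0 ?mulr_ge0 ?exprn_ge0//; exact: eh.
rewrite mulrAC; exact: XBplus_geometric_series (fun j => (eB j).1) (fun j => (eB j).2).
Qed.

End SequencesInX.

Lemma lipschitz_cvgn {R : realType} {X : completeNormedModType R} (g : X -> X)
    (K : R) (u : nat -> X) (l : X) :
  (forall x y, `|g x - g y| <= K * `|x - y|) ->
  u @ \oo --> l -> g \o u @ \oo --> g l.
Proof.
move=> gK ul; apply/cvgrPdist_lt => e e0.
have K1 : 0 < `|K| + 1 by rewrite ltr_wpDl.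
have /cvgrPdist_lt/(_ _ (divr_gt0 e0 K1))[N _ HN] := ul.
exists N => // n /HN /= ln.
apply: le_lt_trans (gK _ _) _; apply: (@le_lt_trans _ _ ((`|K| + 1) * `|l - u n|)).
  by rewrite ler_wpM2r// (le_trans (ler_norm K))// lerDl.
by rewrite -ltr_pdivlMl// mulrC.
Qed.

Lemma bounded_linear_cvgn {R : realType} {X : completeNormedModType R}
    (T : {linear X -> X}) (u : nat -> X) (l : X) :
  bounded_op T -> u @ \oo --> l -> T \o u @ \oo --> T l.
Proof.
by move=> [K TK]; apply: (lipschitz_cvgn (K := K)) => x y; rewrite -linearB.
Qed.

(** * Solving the affine equation under a dichotomy *)

(** A quantitative form of Perron's admissibility property.  The initial value
    [d 0] is left free: in the presence of an unstable direction it cannot be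
    prescribed. *)
Definition affine_solvable {R : realType} {X : completeNormedModType R}
    (A : nat -> {linear X -> X}) (B : normedSeqSpace R) (K : R) : Prop :=
  forall h : nat -> X, XBplus B h ->
  exists d : nat -> X, [/\ XBplus B d, normXBplus B d <= K * normXBplus B h &
    forall m, d m.+1 = A m (d m) + h m].

Section DichotomySolvable.
Context {R : realType} {X : completeNormedModType R}.
Variables (A : nat -> {linear X -> X}) (B : normedSeqSpace R).
Variables (P : nat -> {linear X -> X}) (C q : R).
Hypothesis A_bounded : forall m, bounded_op (A m).
Hypothesis B_adm : admissible B.
Hypotheses (C0 : 0 <= C) (q01 : 0 <= q < 1).

(** Transports the stable part of the past forwards.  The [j]-th term
    at time [m] stems from the forcing [h] applied [j] steps before the last
    one, whence the cut-off [j < m] and the displacement [- (j + 1)].  Applying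
    [A m] turns the [j]-th term at [m] into the [j+1]-st term at [m + 1], and
    the new [0]-th term is the stable part of [h m]. *)
Lemma stable_part_solvable (h : nat -> X) :
  (forall m n, (n <= m)%N ->
    opnorm_le (evolution A P m n \o P n) (C * q ^+ (m - n))) ->
  XBplus B h ->
  exists s : nat -> X,
    [/\ XBplus B s, normXBplus B s <= C / (1 - q) * normXBplus B h &
      forall m, s m.+1 = A m (s m) + P m.+1 (h m)].
Proof.
move=> evP Bh; have /andP[q0 _] := q01.
pose e j m : X := if (j < m)%N then
  compose_from A (m - j) j (P (m - j)%N (h (m - j).-1)) else 0.
have [|s [Bs sh es]] := @XBplus_shifted_series _ _ _ h e (fun j => - j.+1%:Z) C q
    B_adm C0 q01 Bh.
  move=> j m; rewrite /e; case: ltnP => jm; last first.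
    by rewrite normr0 mulr_ge0// mulr_ge0// exprn_ge0.
  have -> : m%:Z - j.+1%:Z = (m - j).-1%:Z by lia.
  have := evP m (m - j)%N (leq_subr _ _) (h (m - j).-1).
  by rewrite /= /evolution leq_subr subKn// ltnW.
exists s; split => // m.
have eS j : e j.+1 m.+1 = A m (e j m).
  by rewrite /e ltnS subSS; case: ltnP => jm; rewrite ?linear0//= subnK// ltnW.
have := es m.+1; rewrite -cvg_shiftS => es1.
apply: (cvg_unique _ es1 _) => //.
have -> : [sequence series (e^~ m.+1) N.+1]_N =
    (A m \o series (e^~ m)) \+ cst (P m.+1 (h m)).
  apply/funext => N; rewrite /series /= big_nat_recl// linear_sum addrC.
  by congr (_ + _); apply: eq_bigr => j _; exact: eS.
by apply: cvgD; [exact: bounded_linear_cvgn|exact: cvg_cst].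
Qed.

Lemma compose_from_recl (m k : nat) (x : X) :
  compose_from A m k.+1 x = compose_from A m.+1 k (A m x).
Proof.
elim: k => [|k IH]; first by rewrite /= addn0.
by rewrite -[LHS]/(A (m + k.+1)%N (compose_from A m k.+1 x)) IH /= addSnnS.
Qed.

Hypothesis A_bij :
  forall m, set_bij (null_space (P m)) (null_space (P m.+1)) (A m).

Lemma compose_from_bij (m k : nat) :
  set_bij (null_space (P m)) (null_space (P (m + k)%N)) (compose_from A m k).
Proof.
elim: k => [|k IH]; first by rewrite addn0; split=> // x Px; exists x.
by rewrite addnS /=; apply: set_bij_comp IH _; exact: A_bij.
Qed.

(** The backward evolution does invert the forward one on the kernels: vectors
    of [null_space (P (m + k.+1))] lie in the image on which the partial inverse
    is meaningful. *)
Lemma evolution_backward (m k : nat) (y : X) : P (m + k.+1)%N y = 0 ->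
  P m (evolution A P m (m + k.+1) y) = 0 /\
  compose_from A m k.+1 (evolution A P m (m + k.+1) y) = y.
Proof.
move=> Py; have -> : evolution A P m (m + k.+1) =
    'pinv_(fun=> 0) (null_space (P m)) (compose_from A m k.+1).
  by rewrite /evolution leqNgt -{1}[m]addn0 ltn_add2l addKn.
have mk_surj := set_bij_surj (compose_from_bij m k.+1).
have y_im : y \in compose_from A m k.+1 @` null_space (P m).
  by apply/mem_set; exact: mk_surj.
split; last exact: (pinvK (fun=> 0) y_im).
by apply: (surjpinv_image_sub mk_surj); exists y.
Qed.

(** Transports the unstable part of the future backwards.  By injectivity of
    the evolution on the kernels, [A m] turns the [j+1]-st term at [m] into the
    [j]-th term at [m + 1], while the [0]-th term gives back the unstable part of
    [h m]; thus [- u] solves the equation forced by that unstable part. *)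
Lemma unstable_part_solvable (h : nat -> X) :
  (forall m x, P m (P m x) = P m x) ->
  (forall m x, P m.+1 (A m x) = A m (P m x)) ->
  (forall m n, (m <= n)%N ->
    opnorm_le (evolution A P m n \o (fun x => x - P n x)) (C * q ^+ (n - m))) ->
  XBplus B h ->
  exists u : nat -> X,
    [/\ XBplus B u, normXBplus B u <= C / (1 - q) * normXBplus B h &
      forall m, A m (u m) = (h m - P m.+1 (h m)) + u m.+1].
Proof.
move=> P_idem PA evQ Bh; have /andP[q0 q1] := q01.
pose y n := h n - P n.+1 (h n).
have Py n : P n.+1 (y n) = 0 by rewrite linearB /= P_idem subrr.
pose e j m := evolution A P m (m + j.+1) (y (m + j)%N).
have eP j m : P m (e j m) = 0 /\ compose_from A m j.+1 (e j m) = y (m + j)%N.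
  by apply: evolution_backward; rewrite addnS.
have [|u [Bu uh eu]] := @XBplus_shifted_series _ _ _ h e Posz C q
    B_adm C0 q01 Bh.
  move=> j m.
  have /= := evQ m (m + j.+1)%N (leq_addr _ _) (h (m + j)%N).
  rewrite addKn /e /y [(m + j.+1)%N]addnS => /le_trans; apply.
  rewrite ler_wpM2r// ler_wpM2l// exprS ler_piMl ?exprn_ge0//; exact: ltW.
exists u; split => // m.
have e0 : A m (e 0%N m) = y m by have := (eP 0%N m).2; rewrite /= !addn0.
have eS j : A m (e j.+1 m) = e j m.+1.
  have /set_bij_inj inj := compose_from_bij m.+1 j.+1.
  apply: inj.
  - by rewrite inE /null_space /= PA (eP _ _).1 linear0.
  - by rewrite inE; exact: (eP _ _).1.
  - by rewrite -compose_from_recl (eP j.+1 m).2 (eP j m.+1).2 addSnnS.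
(* Drop the empty partial sum, so that the [0]-th term can be split off. *)
have := eu m; rewrite -cvg_shiftS => /(bounded_linear_cvgn (A_bounded m)) eu1.
apply: (cvg_unique _ eu1 _) => //.
have -> : A m \o [sequence series (e^~ m) N.+1]_N =
    cst (y m) \+ series (e^~ m.+1).
  apply/funext => N; rewrite /series /= big_nat_recl// linearD /= e0 linear_sum.
  by congr (_ + _); apply: eq_bigr => j _; exact: eS.
by apply: cvgD; [exact: cvg_cst|exact: eu].
Qed.

End DichotomySolvable.

(** The difference of the stable and unstable solutions solves the full
    equation, the two parts of [h] adding up to [h]. *)
Lemma dichotomy_affine_solvable {R : realType} {X : completeNormedModType R}
    (A : nat -> {linear X -> X}) (B : normedSeqSpace R) :
  (forall m, bounded_op (A m)) -> exponential_dichotomy A -> admissible B ->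
  exists2 K, 0 < K & affine_solvable A B K.
Proof.
move=> Abd [P [P_idem PA A_bij [C [lambda [C0 l0 evP evQ]]]]] Badm.
pose q := expR (- lambda).
have q0 : 0 < q by exact: expR_gt0.
have q1 : q < 1 by rewrite expR_lt1 oppr_lt0.
have qE k : expR (- lambda * k%:R) = q ^+ k by exact: expRM_natr.
have q01 : 0 <= q < 1 by rewrite ltW.
exists (C / (1 - q) + C / (1 - q)).
  by rewrite addr_gt0// divr_gt0// subr_gt0.
move=> h Bh.
have [|s [Bs sh sE]] := stable_part_solvable (P := P) Abd Badm (ltW C0) q01 _ Bh.
  by move=> m n nm; rewrite -qE; exact: evP.
have [|u [Bu uh uE]] := unstable_part_solvable Abd Badm (ltW C0) q01 A_bij P_idem PA _ Bh.
  by move=> m n nm; rewrite -qE; exact: evQ.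
have [Bsu su] := XBplusB Bs Bu.
exists (fun m => s m - u m); split => //.
  by apply: le_trans su _; rewrite mulrDl lerD.
move=> m; rewrite linearB /= uE sE.
by rewrite opprD opprB -!addrA; congr (_ + (_ + _)); rewrite [- _ + h m]addrC addKr.
Qed.

(** * Shadowing by successive corrections *)

(** The threshold [K * c < 1] is the contraction condition, and the choice
    [eps * (1 - K * c) / K] of [delta] makes the first correction at most
    [eps * (1 - K * c)], so that all of them add up to at most [eps]. *)
Lemma affine_solvable_shadowing {R : realType} {X : completeNormedModType R}
    (A : nat -> {linear X -> X}) (B : normedSeqSpace R) (K c : R)
    (f : nat -> X -> X) :
  (forall m, bounded_op (A m)) -> admissible B -> affine_solvable A B K ->
  0 < K -> 0 <= c -> K * c < 1 ->
  (forall n x y, `|f n x - f n y| <= c * `|x - y|) ->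
  shadowing_property B (fun n x => A n x + f n x).
Proof.
move=> Abd Badm AK K0 c0 Kc1 fc eps eps0.
set q := K * c in Kc1.
have q01 : 0 <= q < 1 by rewrite Kc1 mulr_ge0// ltW.
have q1 : 0 < 1 - q by rewrite subr_gt0.
exists (eps * (1 - q) / K); first by rewrite divr_gt0// mulr_gt0.
move=> y [Bw wdelta].
set w := (fun n => _) in Bw wdelta.
have /choice[G GP] h : exists d, XBplus B h ->
    [/\ XBplus B d, normXBplus B d <= K * normXBplus B h &
      forall m, d m.+1 = A m (d m) + h m].
  have [/AK[d dP]|nBh] := pselect (XBplus B h); first by exists d.
  by exists h => /nBh.
pose g n v := f n (y n + v) - f n (y n).
have gc n v v' : `|g n v - g n v'| <= c * `|v - v'|.
  by rewrite /g opprB addrA subrK (le_trans (fc _ _ _))// opprD addrACA subrr add0r.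
(* [zd k] is the pair of the [k]-th approximation and of the next correction.
   The forcing of that correction makes up for the change of [g] due to the
   previous one, which [zE] below records as a one-step lag in [g]. *)
pose fix zd k : (nat -> X) * (nat -> X) :=
  if k is k'.+1 then let: (z, d) := zd k' in
    (z \+ d, G (fun n => g n (z n + d n) - g n (z n)))
  else (cst 0, G (fun n => - w n)).
pose z k := (zd k).1.
pose d k := (zd k).2.
have zS k : z k.+1 = z k \+ d k by rewrite /z /d /=; case: (zd k).
have dS k : d k.+1 = G (fun n => g n (z k.+1 n) - g n (z k n)).
  by rewrite zS /z /d /=; case: (zd k).
have [BNw Nw] : XBplus B (fun n => - w n) /\
    normXBplus B (fun n => - w n) <= 1 * normXBplus B w.
  by apply: XBplus_lipschitz => // n; rewrite normrN mul1r.
have [Bd0 d0w d0E] := GP _ BNw.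
have hP k : XBplus B (d k) ->
    XBplus B (fun n => g n (z k.+1 n) - g n (z k n)) /\
    normXBplus B (fun n => g n (z k.+1 n) - g n (z k n)) <= c * normXBplus B (d k).
  move=> Bd; apply: XBplus_lipschitz => // n.
  by rewrite (le_trans (gc _ _ _))// zS addrC addKr.
have Bd k : XBplus B (d k).
  by elim: k => // k /hP[/GP[Bd _ _] _]; rewrite dS.
have dM k : normXBplus B (d k) <= eps * (1 - q) * q ^+ k.
  elim: k => [|k IH].
    rewrite mulr1 (le_trans d0w)// -ler_pdivlMl// mulrC.
    by rewrite (le_trans Nw)// mul1r.
  have [Bh hd] := hP k (Bd k); have [_ + _] := GP _ Bh; rewrite -dS => /le_trans.
  apply; rewrite exprS mulrCA /q -mulrA ler_wpM2l ?(ltW K0)//.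
  by rewrite (le_trans hd)// ler_wpM2l.
have zE k m : z k.+1 m.+1 = A m (z k.+1 m) + g m (z k m) - w m.
  elim: k => [|k IH].
    by rewrite zS /z /d /= !add0r d0E /g addr0 subrr addr0.
  have [_ _ dE] := GP _ (hP k (Bd k)).1.
  rewrite zS /= IH dS dE -dS [A m (_ + _)]linearD /=.
  move: (g m (z k.+1 m)) (g m (z k m)) (w m) => a b t.
  rewrite -!addrA; congr (_ + _).
  by rewrite [b + _]addrC -!addrA addNr addr0 addrC -addrA.
have [v [Bv vM dv]] := XBplus_geometric_series Badm q01 Bd dM.
have zv m : z^~ m @ \oo --> v m.
  rewrite (_ : z^~ m = series (d^~ m)) //; apply/funext.
  by elim=> [|k IH]; rewrite ?zS /= ?seriesSr ?IH// /series /= big_geq.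
have vE m : v m.+1 = A m (v m) + g m (v m) - w m.
  have := zv m.+1; rewrite -cvg_shiftS => zv1.
  apply: (cvg_unique _ zv1 _) => //.
  have -> : [sequence z k.+1 m.+1]_k =
      (A m \o [sequence z k.+1 m]_k) \+ (g m \o z^~ m) \- cst (w m).
    by apply/funext => k; exact: zE.
  apply: cvgB; last exact: cvg_cst.
  apply: cvgD; last exact: lipschitz_cvgn (gc m) (zv m).
  apply: bounded_linear_cvgn => //.
  by have := zv m; rewrite -cvg_shiftS.
exists (fun n => y n + v n).
have yvK : (fun n => y n + v n - y n) = v by apply/funext => n; rewrite addrC addKr.
rewrite yvK; split => //.
  move=> n; rewrite vE [A n (_ + _)]linearD /= /g /w opprB.
  move: (A n (y n)) (A n (v n)) (f n (y n)) (f n (y n + v n)) => a b s t.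
  rewrite [LHS]addrC addrA subrK [a + s]addrC addrA -(addrA b) subrK.
  by rewrite [LHS]addrC addrA.
by apply: le_trans vM _; rewrite mulfK// gt_eqF.
Qed.

Theorem theorem5 (R : realType) (X : completeNormedModType R)
    (A : nat -> {linear X -> X}) (B : normedSeqSpace R)
    (A_bounded : forall m : nat, bounded_op (A m))
    (A_dichotomy : exponential_dichotomy A)
    (B_admissible : admissible B) :
  exists2 c0 : R, 0 < c0 &
  forall c : R, 0 < c -> c < c0 ->
  forall f : nat -> X -> X,
    (forall (n : nat) (x y : X), `|f n x - f n y| <= c * `|x - y|) ->
    shadowing_property B (fun (n : nat) (x : X) => A n x + f n x).
Proof.
have [K K0 AK] := dichotomy_affine_solvable A_bounded A_dichotomy B_admissible.
exists K^-1; first by rewrite invr_gt0.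
move=> c c0 cK f fc; apply: (affine_solvable_shadowing A_bounded B_admissible AK K0 (ltW c0) _ fc).
by rewrite -ltr_pdivlMl// mulr1.
Qed.
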